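(* Let $\boldsymbol f=(f_1,\dots,f_n)\in\mathbb R^n$ have prior $p(\boldsymbol f)=\mathcal N(\boldsymbol f\mid\boldsymbol\mu_0,K)$ with $\boldsymbol\mu_0\in\mathbb R^n$ and $K\in\mathbb R^{n\times n}$ symmetric positive definite, let $\boldsymbol y=(y_1,\dots,y_n)\in\mathbb R^n$, let $\varphi$ be a positive definite radial function, and consider the augmented model $$p(\boldsymbol y,\boldsymbol f,\boldsymbol\omega)=p(\boldsymbol f)\prod_{i=1}^n C\exp\big(g(y_i)f_i-\|h(f_i,y_i)\|_2^2\,\omega_i\big)\,\pi_\varphi(\omega_i\mid0),\qquad \boldsymbol\omega=(\omega_1,\dots,\omega_n)\in[0,\infty)^n,$$ where $C>0$ is a constant, $g$ is a real-valued function, and $\|h(f_i,y_i)\|_2^2=\alpha(y_i)-\beta(y_i)f_i+\gamma(y_i)f_i^2$ with $h$ linear in $f_i$. Then the complete conditional distributions of this model are $$p(\omega_i\mid f_i,y_i)=\pi_\varphi\big(\omega_i\mid\|h(f_i,y_i)\|_2\big),\qquad i=1,\dots,n,$$ $$p(\boldsymbol f\mid\boldsymbol y,\boldsymbol\omega)=\mathcal N(\boldsymbol f\mid\boldsymbol\mu,\boldsymbol\Sigma),$$ where $$\boldsymbol\Sigma=\big(\operatorname{diag}(2\boldsymbol\omega\circ\gamma(\boldsymbol y))+K^{-1}\big)^{-1},\qquad \boldsymbol\mu=\boldsymbol\Sigma\big(g(\boldsymbol y)+\boldsymbol\omega\circ\beta(\boldsymbol y)+K^{-1}\boldsymbol\mu_0\big),$$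 $\circ$ denotes the Hadamard (entrywise) product and $g,\beta,\gamma$ are applied to $\boldsymbol y$ entrywise.
   Context: Positive definite radial function: a function $\varphi:[0,\infty)\to\mathbb R$ that is completely monotone and satisfies $\lim_{r\to0}\varphi(r)=1$. Completely monotone means: $\varphi$ is continuous on $[0,\infty)$, infinitely differentiable on $(0,\infty)$, and $(-1)^k\varphi^{(k)}(r)>0$ for all $r\in(0,\infty)$ and $k=0,1,2,\dots$. The function $h$: for each $y_i$, the map $f_i\mapsto h(f_i,y_i)\in\mathbb R^m$ is linear (possibly with a constant term, i.e. affine), so that $\|h(f_i,y_i)\|_2^2=\alpha(y_i)-\beta(y_i)f_i+\gamma(y_i)f_i^2$ for some real-valued functions $\alpha,\beta,\gamma$. The distributions $\pi_\varphi$: $\pi_\varphi(\cdot\mid0)=\mathcal L^{-1}\{\varphi\}$ is the inverse Laplace transform of $\varphi$, i.e. the unique probability measure on $[0,\infty)$ with $\int_0^\infty e^{-r\omega}\,\pi_\varphi(d\omega\mid0)=\varphi(r)$ for all $r\ge0$. For $c\in\mathbb R$, $$\pi_\varphi(d\omega\mid c)=\frac{e^{-c^2\omega}\,\pi_\varphi(d\omega\mid0)}{\varphi(c^2)} .$$ Complete conditionals: the complete conditional of one variable is its normalized conditional distribution given all the others and $\boldsymbol y$, obtained from the joint $p(\boldsymbol y,\boldsymbol f,\boldsymbol\omega)$ with $\boldsymbol y$ fixed: $p(\boldsymbol f\mid\boldsymbol y,\boldsymbol\omega)\propto p(\boldsymbol f)\prod_i\exp(g(y_i)f_i-\|h(f_i,y_i)\|_2^2\omega_i)$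 as a distribution of $\boldsymbol f$, and $p(\omega_i\mid f_i,y_i)\propto\exp(-\|h(f_i,y_i)\|_2^2\omega_i)\,\pi_\varphi(d\omega_i\mid0)$ as a distribution of $\omega_i$. *)

(* Defs.v *)
From HB Require Import structures.
From mathcomp Require Import all_boot all_order all_algebra.
From mathcomp Require Import all_classical all_reals all_analysis.

Set Implicit Arguments.
Unset Strict Implicit.
Unset Printing Implicit Defensive.

Import Order.TTheory GRing.Theory Num.Theory.
Import numFieldNormedType.Exports.

Local Open Scope classical_set_scope.
Local Open Scope ring_scope.

Lemma sigma_finite_product d1 d2 (T1 : measurableType d1)
    (T2 : measurableType d2) (R : realType)
    (m1 : {sigma_finite_measure set T1 -> \bar R})
    (m2 : {sigma_finite_measure set T2 -> \bar R}) :
  sigma_finite setT (m1 \x m2)%E.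
Proof.
have /sigma_finiteP[F [TF ndF Foo]] := sigma_finiteT m1.
have /sigma_finiteP[G [TG ndG Goo]] := sigma_finiteT m2.
exists (fun k => F k `*` G k).
  rewrite -setXTT TF TG predeqE => -[x y]; split.
    move=> [/= [k _ Fkx] [l _ Gly]]; exists (maxn k l) => //; split.
    - by move: x Fkx; exact/subsetPset/ndF/leq_maxl.
    - by move: y Gly; exact/subsetPset/ndG/leq_maxr.
  by move=> [k _ []/= ? ?]; split; exists k.
move=> k; have [? ?] := Foo k; have [? ?] := Goo k.
split; first exact: measurableX.
by rewrite product_measure1E// lte_mul_pinfty// ge0_fin_numE.
Qed.

(* Lebesgue measure on R^n, carried by n.-tuple R with its product
   sigma-algebra: the image of lebesgue_measure \x (Lebesgue measure on R^n)
   under (x, t) |-> x :: t, starting from the unit mass on R^0. *)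
Section lebesgue_tuple.
Context {R : realType}.
Local Notation RR := (measurableTypeR R).

Definition tuple_cons n (p : RR * n.-tuple RR) : n.+1.-tuple RR :=
  [the n.+1.-tuple RR of p.1 :: p.2].

Lemma measurable_tuple_cons n : measurable_fun setT (@tuple_cons n).
Proof. exact: measurable_cons. Qed.

Section step.
Context n (m : {sigma_finite_measure set (n.-tuple RR) -> \bar R}).

Definition lebesgue_step : set (n.+1.-tuple RR) -> \bar R :=
  pushforward (lebesgue_measure \x m)%E (@tuple_cons n).

Let lebesgue_step0 : lebesgue_step set0 = 0%E.
Proof. by rewrite /lebesgue_step /pushforward preimage_set0 measure0. Qed.

Let lebesgue_step_ge0 A : (0 <= lebesgue_step A)%E.
Proof. by rewrite /lebesgue_step /pushforward; exact: measure_ge0. Qed.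

Let mpre A : measurable A -> measurable (@tuple_cons n @^-1` A).
Proof.
by move=> mA; rewrite -[X in measurable X]setTI; exact: measurable_tuple_cons.
Qed.

Let lebesgue_step_sigma_additive : semi_sigma_additive lebesgue_step.
Proof.
move=> F mF tF mUF; rewrite /lebesgue_step /pushforward preimage_bigcup.
apply: measure_semi_sigma_additive => [k||].
- exact: mpre.
- apply/trivIsetP => /= i j _ _ ij; rewrite -preimage_setI.
  by move/trivIsetP : tF => /(_ _ _ _ _ ij) ->//; rewrite preimage_set0.
- by rewrite -preimage_bigcup; exact: mpre.
Qed.

HB.instance Definition _ := isMeasure.Build _ _ _ lebesgue_step
  lebesgue_step0 lebesgue_step_ge0 lebesgue_step_sigma_additive.

Let uncons (t : n.+1.-tuple RR) : RR * n.-tuple RR :=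
  (thead t, [tuple of behead t]).

Let measurable_uncons : measurable_fun setT uncons.
Proof.
apply/measurable_fun_pairP; split; first exact: measurable_tnth.
exact: measurable_behead.
Qed.

Let lebesgue_step_sigma_finite : sigma_finite setT lebesgue_step.
Proof.
have [F TF mF] := sigma_finite_product lebesgue_measure m.
exists (fun k => uncons @^-1` F k).
  by rewrite -preimage_bigcup -TF preimage_setT.
move=> k; have [mFk Fk] := mF k; split.
  by rewrite -[X in measurable X]setTI; exact: measurable_uncons.
rewrite /lebesgue_step /pushforward -comp_preimage.
rewrite (_ : uncons \o _ = id) ?preimage_id//.
apply/funext => -[x t]; rewrite /uncons /= theadE; congr pair.
exact: val_inj.
Qed.

HB.instance Definition _ := Measure_isSigmaFinite.Build _ _ _ lebesgue_step
  lebesgue_step_sigma_finite.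

End step.

Fixpoint lebesgue_tuple n : {sigma_finite_measure set (n.-tuple RR) -> \bar R} :=
  match n with
  | 0 => [the {sigma_finite_measure set (0.-tuple RR) -> \bar R}
           of @dirac _ (0.-tuple RR) [tuple] R]
  | k.+1 => [the {sigma_finite_measure set (k.+1.-tuple RR) -> \bar R}
              of lebesgue_step (lebesgue_tuple k)]
  end.

Lemma measurable_box n (A : 'I_n -> set RR) : (forall i, measurable (A i)) ->
  measurable [set t : n.-tuple RR | forall i, A i (tnth t i)].
Proof.
move=> mA; rewrite (_ : [set t | _] =
    \bigcap_(i in [set: 'I_n]) ((@tnth n RR ^~ i) @^-1` A i)); last first.
  by apply/seteqP; split => t /= tA => [i _|i]; exact: tA.
apply: fin_bigcap_measurable => // i _.
by rewrite -[X in measurable X]setTI; exact: measurable_tnth.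
Qed.

Lemma lebesgue_tuple_box n (A : 'I_n -> set RR) :
  (forall i, measurable (A i)) ->
  lebesgue_tuple n [set t | forall i, A i (tnth t i)] =
  (\prod_(i < n) lebesgue_measure (A i))%E.
Proof.
elim: n A => [|n IHn] A mA /=.
  by rewrite big_ord0 diracE mem_set// => -[].
rewrite big_ord_recl /lebesgue_step /pushforward.
rewrite (_ : _ @^-1` _ = A ord0 `*`
    [set t | forall i, A (lift ord0 i) (tnth t i)]); last first.
  apply/seteqP; split => -[x t] /=.
    by move=> At; split => [|i]; [exact: (At ord0)|have := At (lift ord0 i); rewrite tnthS].
  by move=> [Ax At] i; case: (unliftP ord0 i) => [j|] ->; rewrite ?tnthS//; exact: At.
rewrite (product_measure1E lebesgue_measure (lebesgue_tuple n))//.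
  by congr (_ * _)%E; exact: (IHn (fun i => A (lift ord0 i))).
exact: (@measurable_box n (fun i => A (lift ord0 i))).
Qed.

End lebesgue_tuple.

(* phi is only used on [0, +oo[: its values at negative reals are junk. *)
Definition completely_monotone (R : realType) (phi : R -> R) : Prop :=
  [/\ {within `[0, +oo[, continuous phi},
      forall (k : nat) (r : R), 0 < r -> derivable (derive1n k phi) r 1 &
      forall (k : nat) (r : R), 0 < r -> 0 < (-1) ^+ k * derive1n k phi r].

Definition pd_radial (R : realType) (phi : R -> R) : Prop :=
  completely_monotone phi /\ phi r @[r --> 0^'+] --> (1 : R).

(* P is the inverse Laplace transform of phi: a probability measure on the
   line, carried by [0, +oo[, whose Laplace transform is phi. *)
Definition inverse_laplace (R : realType) (phi : R -> R)
    (P : probability (measurableTypeR R) R) : Prop :=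
  P [set` `[0, +oo[] = 1%E /\
  forall r : R, 0 <= r ->
    (\int[P]_(w in `[0%R, +oo[) (expR (- (r * w)))%:E = (phi r)%:E)%E.

(* pi_phi( . | c), where pi0 = pi_phi( . | 0) *)
Definition pi_phi (R : realType) (phi : R -> R)
    (pi0 : probability (measurableTypeR R) R) (c : R)
    (A : set (measurableTypeR R)) : \bar R :=
  (\int[pi0]_(w in A) (expR (- (c ^+ 2 * w)))%:E * ((phi (c ^+ 2))^-1)%:E)%E.

(* The matrix library's `|v| is the sup norm. *)
Definition norm2 (R : realType) (m : nat) (v : 'cV[R]_m) : R :=
  Num.sqrt (\sum_(j < m) v j 0 ^+ 2).

Definition affine_fun (R : realType) (m : nat) (u : R -> 'cV[R]_m) : Prop :=
  exists a b : 'cV[R]_m, forall t : R, u t = a + t *: b.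

Definition sym_posdef (R : realType) (n : nat) (K : 'M[R]_n) : Prop :=
  K^T = K /\
  forall x : 'cV[R]_n, x != 0 -> 0 < (x^T *m K *m x) 0 0.

Definition hadamard (R : realType) (n : nat) (u v : 'cV[R]_n) : 'cV[R]_n :=
  map2_mx *%R u v.

Definition tvec (R : realType) (n : nat) (t : n.-tuple (measurableTypeR R)) :
  'cV[R]_n := \col_(i < n) tnth t i.

Definition set_tnth (T : Type) (n : nat) (t : n.-tuple T) (i : 'I_n) (w : T) :
  n.-tuple T := [tuple if j == i then w else tnth t j | j < n].

Definition gaussian_pdf (R : realType) (n : nat) (mu : 'cV[R]_n)
    (S : 'M[R]_n) (x : 'cV[R]_n) : R :=
  (Num.sqrt ((2 * pi) ^+ n * \det S))^-1 *
  expR (- (((x - mu)^T *m invmx S *m (x - mu)) 0 0 / 2)).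

Definition gaussian (R : realType) (n : nat) (mu : 'cV[R]_n) (S : 'M[R]_n)
    (A : set (n.-tuple (measurableTypeR R))) : \bar R :=
  (\int[lebesgue_tuple n]_(t in A) (gaussian_pdf mu S (tvec t))%:E)%E.

(* Density of p(y, f, omega), y fixed, with respect to
   (Lebesgue measure on R^n)(df) * prod_i pi_phi(domega_i | 0);
   pi_phi( . | 0) need not have a density of its own. *)
Definition joint (R : realType) (n m : nat) (mu0 : 'cV[R]_n) (K : 'M[R]_n)
    (C : R) (g : R -> R) (h : R -> R -> 'cV[R]_m) (y : 'cV[R]_n)
    (f omega : n.-tuple (measurableTypeR R)) : R :=
  gaussian_pdf mu0 K (tvec f) *
  \prod_(i < n)
    (C * expR (g (y i 0) * tnth f i
               - norm2 (h (tnth f i) (y i 0)) ^+ 2 * tnth omega i)).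

(* q is a density with respect to nu, possibly not normalized; the
   normalization is meaningful only when 0 < total_mass nu q < +oo. *)
Definition total_mass d (T : measurableType d) (R : realType)
    (nu : {measure set T -> \bar R}) (q : T -> R) : \bar R :=
  (\int[nu]_x (q x)%:E)%E.

Definition normalized d (T : measurableType d) (R : realType)
    (nu : {measure set T -> \bar R}) (q : T -> R) (A : set T) : \bar R :=
  (\int[nu]_(x in A) (q x)%:E * ((fine (total_mass nu q))^-1)%:E)%E.

(* The complete conditional of a variable is D, for a joint density whose
   slice along that variable (all other variables frozen) is q. *)
Definition complete_conditional d (T : measurableType d) (R : realType)
    (nu : {measure set T -> \bar R}) (q : T -> R) (D : set T -> \bar R) : Prop :=
  (0 < total_mass nu q < +oo)%E /\
  forall A : set T, measurable A -> normalized nu q A = D A.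

(* Main.v *)
(* With omega fixed, the log-joint is a quadratic in f whose matrix is the
   precision diag(2 omega o gamma) + K^-1, so completing the square turns the
   joint into a positive constant times the density of N(mu, Sigma); only the
   normalization of the latter needs analysis. It follows by induction on the
   dimension: integrating out one coordinate is a one-dimensional Gaussian
   integral, and leaves the Gaussian integral of the Schur complement. With f
   fixed, the joint is a positive constant times exp(- |h|^2 omega_i), whose
   total mass under pi_phi( . | 0) is the Laplace transform phi(|h|^2). *)
Require Import Defs.
From HB Require Import structures.
From mathcomp Require Import all_boot all_order all_algebra.
From mathcomp Require Import all_classical all_reals all_analysis.
From mathcomp Require Import measurable_realfun ring lra.

Set Implicit Arguments.
Unset Strict Implicit.
Unset Printing Implicit Defensive.

Import Order.TTheory GRing.Theory Num.Theory.
Import numFieldNormedType.Exports.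

Local Open Scope classical_set_scope.
Local Open Scope ring_scope.

Local Notation qform A x := ((x^T *m A *m x) 0 0).

(** * Quadratic forms, Schur complements and positive definite matrices *)

Section quadratic_forms.
Context {R : realType}.

Lemma qformDl n (A B : 'M[R]_n) (x : 'cV[R]_n) :
  qform (A + B) x = qform A x + qform B x.
Proof. by rewrite mulmxDr mulmxDl mxE. Qed.

Lemma qformZl n a (A : 'M[R]_n) (x : 'cV[R]_n) :
  qform (a *: A) x = a * qform A x.
Proof. by rewrite -scalemxAr -scalemxAl mxE. Qed.

Lemma qform_diag n (d : 'rV[R]_n) (x : 'cV[R]_n) :
  qform (diag_mx d) x = \sum_i d 0 i * x i 0 ^+ 2.
Proof.
rewrite -mulmxA mxE; apply: eq_bigr => i _.
rewrite mul_diag_mx !mxE; ring.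
Qed.

Lemma dot_sum n (u v : 'cV[R]_n) : (u^T *m v) 0 0 = \sum_i u i 0 * v i 0.
Proof. by rewrite mxE; apply: eq_bigr => i _; rewrite mxE. Qed.

Lemma dotC n (u v : 'cV[R]_n) : (u^T *m v) 0 0 = (v^T *m u) 0 0.
Proof. by rewrite !dot_sum; apply: eq_bigr => i _; rewrite mulrC. Qed.

Lemma qformB n (A : 'M[R]_n) (x c : 'cV[R]_n) : A^T = A ->
  qform A (x - c) = qform A x - 2 * (x^T *m (A *m c)) 0 0 + qform A c.
Proof.
move=> AT; have -> : (x - c)^T = x^T - c^T by rewrite linearB.
rewrite !(mulmxBl, mulmxBr).
have -> : c^T *m A *m x = (x^T *m (A *m c))^T.
  by rewrite !trmx_mul trmxK AT.
rewrite !mulmxA !mxE; ring.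
Qed.

Section schur.
Context n (a : R) (b : 'cV[R]_n) (D : 'M[R]_n).
Hypothesis a0 : a != 0.
Let A : 'M[R]_(1 + n) := block_mx a%:M b^T b D.
Let S : 'M[R]_n := D - a^-1 *: (b *m b^T).

(** Completing the square in the first coordinate: the cross terms are absorbed by the shift
    [(b^T *m v) 0 0 / a], at the cost of the rank-one correction that turns [D] into the Schur
    complement [S]. *)
Lemma qform_schur u (v : 'cV[R]_n) :
  qform A (col_mx u%:M v) =
  a * (u + (b^T *m v) 0 0 / a) ^+ 2 + qform S v.
Proof.
rewrite /A /S tr_col_mx tr_scalar_mx mul_row_block mul_row_col.
rewrite -scaleNr qformDl qformZl.
have -> : qform (b *m b^T) v = ((b^T *m v) 0 0) ^+ 2.
  by rewrite mulmxA -mulmxA [LHS]mxE big_ord1 [(v^T *m b) 0 0]dotC.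
have E : (u%:M *m (b^T *m v)) 0 0 = u * (b^T *m v) 0 0 by rewrite mul_scalar_mx mxE.
have F : (v^T *m b *m u%:M) 0 0 = u * (b^T *m v) 0 0.
  by rewrite mul_mx_scalar mxE [(v^T *m b) 0 0]dotC.
have G : (u%:M *m a%:M *m u%:M : 'M[R]_1) 0 0 = u * a * u.
  by rewrite -!scalar_mxM mxE eqxx mulr1n.
have addE (X Y : 'M[R]_1) : (X + Y) 0 0 = X 0 0 + Y 0 0 by rewrite mxE.
by rewrite !mulmxDl !addE -(mulmxA _ b^T) F G E; field.
Qed.

Lemma det_schur : \det A = a * \det S.
Proof.
(* Block elimination of [b] below the pivot [a]; the left factor is unitriangular by blocks. *)
have -> : A = block_mx 1%:M 0 (a^-1 *: b) 1%:M *m block_mx a%:M b^T 0 S.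
  rewrite mulmx_block !mul1mx !mul0mx !addr0 mul_mx_scalar scalerA.
  by rewrite divff// scale1r -scalemxAl addrC subrK.
by rewrite det_mulmx det_lblock !det1 !mul1r det_ublock det_scalar1.
Qed.

Hypothesis posA : sym_posdef A.

Lemma posdef_schur : sym_posdef S.
Proof.
split.
  have := posA.1; rewrite /A tr_block_mx => /eq_block_mx[_ _ _ DT].
  by rewrite /S linearB/= linearZ/= trmx_mul trmxK DT.
(* The chosen first coordinate makes the square in [qform_schur] vanish, so the form of [A] there
   equals the form of [S] at [v]. *)
move=> v v0; have := posA.2 (col_mx (- ((b^T *m v) 0 0 / a))%:M v).
rewrite qform_schur addNr expr0n mulr0 add0r; apply.
apply: contra v0 => /eqP/(congr1 dsubmx); rewrite col_mxKd => ->.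
by rewrite linear0.
Qed.

End schur.

Lemma sym_block n (A : 'M[R]_(1 + n)) : A^T = A ->
  exists a b D, A = block_mx a%:M b^T b D.
Proof.
move=> AT; exists (A 0 0), (dlsubmx A), (drsubmx A).
rewrite -[LHS]submxK trmx_dlsub AT; congr block_mx.
by rewrite [ulsubmx A]mx11_scalar !mxE lshift0.
Qed.

(** Drives the inductions on dimension. The pivot [a] is positive because it is the value of the
    form at the first basis vector. *)
Lemma posdef_block n (A : 'M[R]_(1 + n)) : sym_posdef A ->
  exists a b D, [/\ A = block_mx a%:M b^T b D, 0 < a &
    sym_posdef (D - a^-1 *: (b *m b^T))].
Proof.
move=> posA; have [a [b [D AE]]] := sym_block posA.1; rewrite AE in posA *.
have a0 : 0 < a.
  have x0 : col_mx 1%:M 0 != 0 :> 'cV[R]_(1 + n).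
    apply/eqP => /(congr1 usubmx)/matrixP/(_ 0 0).
    by rewrite col_mxKu !mxE => /eqP; rewrite oner_eq0.
  have := posA.2 _ x0; rewrite tr_col_mx trmx0 mul_row_block mul_row_col.
  by rewrite mulmx0 !mul0mx !addr0 tr_scalar_mx mul1mx mulmx1 mxE eqxx.
exists a, b, D; split => //; apply: posdef_schur posA; exact: lt0r_neq0.
Qed.

Lemma posdef_det_gt0 n (A : 'M[R]_n) : sym_posdef A -> 0 < \det A.
Proof.
elim: n A => [A _|n IHn A]; first by rewrite det_mx00.
move=> /posdef_block[a [b [D [-> a0 /IHn S0]]]].
by rewrite (det_schur _ _ (lt0r_neq0 a0)) mulr_gt0.
Qed.

Lemma posdef_unit n (A : 'M[R]_n) : sym_posdef A -> A \in unitmx.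
Proof. by move=> /posdef_det_gt0/lt0r_neq0; rewrite unitmxE unitfE. Qed.

(** With [z = invmx A *m x], the form of [invmx A] at [x] is the form of [A] at [z]. *)
Lemma posdef_inv n (A : 'M[R]_n) : sym_posdef A -> sym_posdef (invmx A).
Proof.
move=> posA; have uA := posdef_unit posA.
split; first by rewrite trmx_inv posA.1.
move=> x x0; have Ax0 : invmx A *m x != 0.
  by apply: contra x0 => /eqP xE; rewrite -[x](mulKVmx uA) xE mulmx0.
have := posA.2 _ Ax0.
by rewrite trmx_mul trmx_inv posA.1 -!mulmxA (mulKVmx uA).
Qed.

Lemma posdef_diagD n (d : 'rV[R]_n) (A : 'M[R]_n) :
  (forall i, 0 <= d 0 i) -> sym_posdef A -> sym_posdef (diag_mx d + A).
Proof.
move=> d0 posA; split; first by rewrite linearD/= tr_diag_mx posA.1.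
move=> x x0; rewrite qformDl qform_diag ltr_wpDl ?posA.2//.
by apply: sumr_ge0 => i _; rewrite mulr_ge0// sqr_ge0.
Qed.

End quadratic_forms.

(** * The Gaussian integral in dimension n *)

Section gaussian_integral.
Context {R : realType}.
Local Notation RR := (measurableTypeR R).

(** The integrand is the normal density of mean [m] and standard deviation [s], the inverse square
    root of [a], divided by its peak value. *)
Lemma integral_exp_sqr (a m : R) : 0 < a ->
  (\int[lebesgue_measure]_(x in [set: RR])
     (expR (- (a * (x - m) ^+ 2 / 2)))%:E = (Num.sqrt (2 * pi / a))%:E)%E.
Proof.
move=> a0; pose s := (Num.sqrt a)^-1.
have s0 : s != 0 by rewrite invr_neq0// gt_eqF// sqrtr_gt0.
have s2 : s ^+ 2 = a^-1 by rewrite exprVn sqr_sqrtr// ltW.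
have p0 := normal_peak_gt0 s0.
rewrite (eq_integral (fun x : RR => (normal_peak s)^-1%:E * (normal_pdf m s x)%:E)%E).
  rewrite ge0_integralZl_EFin//.
  - rewrite integral_normal_pdf mule1 /normal_peak invrK s2.
    by congr (Num.sqrt _)%:E; field; exact: lt0r_neq0.
  - by move=> x _; rewrite lee_fin normal_pdf_ge0.
  - by apply/measurable_EFinP; exact: measurable_normal_pdf.
  - by rewrite invr_ge0 ltW.
move=> x _; rewrite normal_pdfE// -EFinM mulKf ?lt0r_neq0//.
rewrite /normal_fun s2; congr (expR _)%:E; field; exact: lt0r_neq0.
Qed.

(** The annotation ['cV[R]_(1 + n)], convertible with ['cV[R]_n.+1], lets the block formulas for
    quadratic forms apply. *)
Lemma tvec_cons n (p : RR * n.-tuple RR) :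
  tvec (tuple_cons p) = col_mx p.1%:M (tvec p.2) :> 'cV[R]_(1 + n).
Proof.
apply/colP => i; rewrite !mxE; case: (splitP i) => j ij.
  rewrite ord1 in ij *; rewrite !mxE eqxx mulr1n.
  by rewrite (_ : i = ord0) ?tnth0//; exact: val_inj.
by rewrite !mxE (_ : i = lift ord0 j) ?tnthS//; exact: val_inj.
Qed.

(** Tonelli, with the first coordinate innermost: that is the coordinate in which the square is
    completed, the others being fixed. *)
Lemma ge0_integral_lebesgue_tupleS n (F : n.+1.-tuple RR -> \bar R) :
  measurable_fun setT F -> (forall t, 0 <= F t)%E ->
  (\int[lebesgue_tuple n.+1]_t F t =
   \int[lebesgue_tuple n]_t \int[lebesgue_measure]_x F (tuple_cons (x, t)))%E.
Proof.
move=> mF F0.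
have mc := @measurable_tuple_cons R n.
rewrite -(fubini_tonelli2 (m1 := lebesgue_measure) (m2 := lebesgue_tuple n)
   (F \o @tuple_cons R n))//.
- have := @ge0_integral_pushforward _ _ _ _ R _ mc
    (lebesgue_measure \x lebesgue_tuple n)%E setT F measurableT mF.
  by apply => t _; exact: F0.
- exact: measurableT_comp.
- by move=> x; exact: F0.
Qed.

Lemma measurable_qform n (P : 'M[R]_n) (mu : 'cV[R]_n) :
  measurable_fun setT (fun t : n.-tuple RR => qform P (tvec t - mu)).
Proof.
rewrite (_ : (fun t => _) = fun t : n.-tuple RR =>
   \sum_i (\sum_j (tnth t j - mu j 0) * P j i) * (tnth t i - mu i 0)).
  apply: measurable_sum => i; apply: measurable_funM; last first.
    by apply: measurable_funB => //; exact: measurable_tnth.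
  apply: measurable_sum => j; apply: measurable_funM => //.
  by apply: measurable_funB => //; exact: measurable_tnth.
apply/funext => t; rewrite mxE; apply: eq_bigr => i _.
by rewrite !mxE; congr (_ * _); apply: eq_bigr => j _; rewrite !mxE.
Qed.

Lemma measurable_exp_qform n (P : 'M[R]_n) (mu : 'cV[R]_n) :
  measurable_fun setT
    (fun t : n.-tuple RR => expR (- (qform P (tvec t - mu) / 2))).
Proof.
apply: measurableT_comp => //; apply: measurableT_comp => //.
by apply: measurable_funM => //; exact: measurable_qform.
Qed.

(** Stated for the precision matrix rather than the covariance: integrating out a coordinate
    replaces [P] by its Schur complement, so the induction hypothesis applies directly. *)
Lemma integral_exp_qform n (P : 'M[R]_n) (mu : 'cV[R]_n) : sym_posdef P ->
  (\int[lebesgue_tuple n]_t (expR (- (qform P (tvec t - mu) / 2)))%:E =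
   (Num.sqrt ((2 * pi) ^+ n / \det P))%:E)%E.
Proof.
elim: n P mu => [|n IHn] P mu posP.
  (* In dimension 0 the measure is the unit mass at the empty tuple and both sides are 1. *)
  rewrite integral_dirac//; last first.
    by apply/measurable_EFinP; exact: measurable_exp_qform.
  rewrite diracE mem_set// mul1e det_mx00 expr0 divr1 sqrtr1.
  by rewrite mxE big_ord0 mul0r oppr0 expR0.
rewrite ge0_integral_lebesgue_tupleS; last 2 first.
  by apply/measurable_EFinP; exact: measurable_exp_qform.
  by move=> t; rewrite lee_fin expR_ge0.
have [a [b [D [PE a0 posS]]]] := posdef_block posP.
set S := D - _ in posS.
have S0 := posdef_det_gt0 posS.
pose nu : 'cV[R]_n := dsubmx (mu : 'cV[R]_(1 + n)).
have qE x t : qform P (tvec (tuple_cons (x, t)) - mu) =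
    a * (x - (mu 0 0 - (b^T *m (tvec t - nu)) 0 0 / a)) ^+ 2 +
    qform S (tvec t - nu).
  have -> : tvec (tuple_cons (x, t)) - mu =
      col_mx (x - mu 0 0)%:M (tvec t - nu) :> 'cV[R]_(1 + n).
    have subE (u v : 'cV[R]_(1 + n)) :
      u - v = col_mx (usubmx u - usubmx v) (dsubmx u - dsubmx v).
      by rewrite -!linearB vsubmxK.
    apply: (etrans (subE _ _)); rewrite tvec_cons col_mxKu col_mxKd.
    congr col_mx; rewrite [usubmx (mu : 'cV_(1 + n))]mx11_scalar mxE lshift0.
    by apply/matrixP => i j; rewrite !mxE mulrnBl.
  by rewrite PE (qform_schur b D (lt0r_neq0 a0)) opprD opprK addrA.
(* The inner integrand is a one-dimensional Gaussian whose centre moves with [t]; its integral does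
   not depend on the centre, so it leaves a constant factor. *)
transitivity (\int[lebesgue_tuple n]_t ((Num.sqrt (2 * pi / a))%:E *
    (expR (- (qform S (tvec t - nu) / 2)))%:E))%E.
  apply: eq_integral => t _.
  rewrite -(integral_exp_sqr (mu 0 0 - (b^T *m (tvec t - nu)) 0 0 / a) a0).
  rewrite muleC -ge0_integralZl_EFin//; last first.
  - apply/measurable_EFinP; apply: measurableT_comp => //.
    apply: measurableT_comp => //; apply: measurable_funM => //.
    apply: measurable_funM => //; apply: measurable_funX.
    exact: measurable_funB.
  - by apply: eq_integral => x _; rewrite -EFinM -expRD qE mulrDl opprD addrC.
rewrite ge0_integralZl_EFin//; last first.
  by apply/measurable_EFinP; exact: measurable_exp_qform.
rewrite IHn// -EFinM -sqrtrM; last by rewrite ltW// divr_gt0// mulr_gt0// pi_gt0.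
rewrite PE (det_schur _ _ (lt0r_neq0 a0)) -/S exprS; congr (Num.sqrt _)%:E.
by field; rewrite !lt0r_neq0.
Qed.
End gaussian_integral.

(** * Recognizing a complete conditional from a proportional density *)

Lemma complete_conditional_density d (T : measurableType d) (R : realType)
    (nu : {measure set T -> \bar R}) (q p : T -> R) (Z : R)
    (D : set T -> \bar R) :
  0 < Z -> (forall x, q x = Z * p x) ->
  measurable_fun setT p -> (forall x, 0 <= p x) ->
  (\int[nu]_x (p x)%:E = 1)%E ->
  (forall A, measurable A -> D A = \int[nu]_(x in A) (p x)%:E)%E ->
  complete_conditional nu q D.
Proof.
move=> Z0 qE mp p0 p1 DE.
have intq A : measurable A ->
    (\int[nu]_(x in A) (q x)%:E = Z%:E * \int[nu]_(x in A) (p x)%:E)%E.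
  move=> mA; rewrite -ge0_integralZl_EFin//; last 3 first.
  - by move=> x _; rewrite lee_fin.
  - by apply/measurable_EFinP; exact: measurable_funTS.
  - exact: ltW.
  by apply: eq_integral => x _; rewrite qE EFinM.
(* Since [p] has mass one, [Z] is exactly the normalizing constant of [q]. *)
have massq : total_mass nu q = Z%:E by rewrite /total_mass intq// p1 mule1.
split; first by rewrite massq lte_fin Z0 ltry.
move=> A mA; rewrite /normalized massq intq//= DE//.
by rewrite muleAC -EFinM divff ?mul1e// gt_eqF.
Qed.

(** * Laplace transforms, Gaussian densities and the sign of the leading coefficient *)

Section densities.
Context {R : realType}.
Local Notation RR := (measurableTypeR R).

(** For [0 < r] this is the case [k = 0] of complete monotonicity. At 0 the Laplace transform is the
    mass of [pi0] on the half-line, which is 1. *)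
Lemma pd_radial_gt0 (phi : R -> R) (pi0 : probability RR R) (r : R) :
  pd_radial phi -> inverse_laplace phi pi0 -> 0 <= r -> 0 < phi r.
Proof.
move=> [[_ _ phi_gt0] _] [pi0_1 lap]; rewrite le_eqVlt => /predU1P[<-|r0].
  have := lap 0 (lexx _).
  under eq_integral do rewrite mul0r oppr0 expR0.
  rewrite integral_cst// mul1e.
  by rewrite [X in X = _]pi0_1 => -[<-].
by have := phi_gt0 0%N r r0; rewrite expr0 mul1r.
Qed.

(** The negative half-line has mass zero under [pi0], so the integral over the whole line is the
    Laplace transform. *)
Lemma integral_inverse_laplace (phi : R -> R) (pi0 : probability RR R) (r : R) :
  inverse_laplace phi pi0 -> 0 <= r ->
  (\int[pi0]_w (expR (- (r * w)))%:E = (phi r)%:E)%E.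
Proof.
move=> [pi0_1 lap] r0; rewrite -lap//.
have mI : measurable ([set` `[0, +oo[] : set RR) by exact: measurable_itv.
rewrite (@ge0_negligible_integral _ _ _ pi0 setT (~` [set` `[0, +oo[]))//.
- by rewrite setTD setCK.
- exact: measurableC.
- apply/measurable_EFinP; apply: measurableT_comp => //.
  by apply: measurableT_comp => //; exact: measurable_funM.
- by apply: etrans (probability_setC pi0 mI) _; rewrite pi0_1 subee.
Qed.

Lemma gaussian_pdf_ge0 n (mu : 'cV[R]_n) (S : 'M[R]_n) x :
  0 <= gaussian_pdf mu S x.
Proof. by rewrite mulr_ge0// ?expR_ge0// invr_ge0 sqrtr_ge0. Qed.

Lemma gaussian_norm_gt0 n (S : 'M[R]_n) : sym_posdef S ->
  0 < (Num.sqrt ((2 * pi) ^+ n * \det S))^-1.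
Proof.
move=> /posdef_det_gt0 S0.
by rewrite invr_gt0 sqrtr_gt0 mulr_gt0// exprn_gt0// mulr_gt0// pi_gt0.
Qed.

Lemma measurable_gaussian_pdf n (mu : 'cV[R]_n) (S : 'M[R]_n) :
  measurable_fun setT (fun t : n.-tuple RR => gaussian_pdf mu S (tvec t)).
Proof. by apply: measurable_funM => //; exact: measurable_exp_qform. Qed.

Lemma integral_gaussian_pdf n (mu : 'cV[R]_n) (S : 'M[R]_n) : sym_posdef S ->
  (\int[lebesgue_tuple n]_t (gaussian_pdf mu S (tvec t))%:E = 1)%E.
Proof.
move=> posS; have S0 := gaussian_norm_gt0 posS.
under eq_integral do rewrite EFinM.
rewrite ge0_integralZl_EFin//; last first.
  by apply/measurable_EFinP; exact: measurable_exp_qform.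
rewrite integral_exp_qform ?det_inv ?invrK; last exact: posdef_inv.
by rewrite -EFinM mulVf// -[X in X != 0]invrK invr_neq0// lt0r_neq0.
Qed.

Lemma quadratic_ge0_lead (a b c : R) :
  (forall t, 0 <= a - b * t + c * t ^+ 2) -> 0 <= c.
Proof.
move=> H; rewrite leNgt; apply/negP => c0.
have := H 0; rewrite mulr0 expr0n mulr0 subr0 addr0 => a0.
(* Adding the inequalities at [t] and [- t] cancels [b] and gives [0 <= a + c * t ^+ 2]. With
   [u = a / c <= 0] the right-hand side is [c * (1 - u + u ^+ 2)], which is negative. *)
pose t := 1 - a / c.
have ac : a / c * c = a by rewrite divfK// lt_eqF.
have ac0 : a / c <= 0 by rewrite mulr_ge0_le0// invr_le0 ltW.
have := H t; have := H (- t); rewrite /t; move: (a / c) ac ac0 => u ac ac0.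
by nra.
Qed.

Lemma prod_cst_expR n (C : R) (e : 'I_n -> R) :
  \prod_i (C * expR (e i)) = C ^+ n * expR (\sum_i e i).
Proof. by rewrite big_split/= prodr_const card_ord expR_sum. Qed.

End densities.

(** * The complete conditionals of the augmented model *)

Theorem theorem2 (R : realType) (n m : nat)
    (mu0 : 'cV[R]_n) (K : 'M[R]_n) (y : 'cV[R]_n)
    (phi : R -> R) (pi0 : probability (measurableTypeR R) R)
    (C : R) (g alpha beta gamma : R -> R) (h : R -> R -> 'cV[R]_m)
    (hK : sym_posdef K)
    (hphi : pd_radial phi)
    (hpi0 : inverse_laplace phi pi0)
    (hC : 0 < C)
    (h_affine : forall i : 'I_n, affine_fun (fun t : R => h t (y i 0)))
    (h_norm : forall (i : 'I_n) (t : R),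
       norm2 (h t (y i 0)) ^+ 2
       = alpha (y i 0) - beta (y i 0) * t + gamma (y i 0) * t ^+ 2) :
  (forall (i : 'I_n) (f omega : n.-tuple (measurableTypeR R)),
     (forall j : 'I_n, 0 <= tnth omega j) ->
     complete_conditional pi0
       (fun w => joint mu0 K C g h y f (set_tnth omega i w))
       (pi_phi phi pi0 (norm2 (h (tnth f i) (y i 0)))))
  /\
  (forall omega : n.-tuple (measurableTypeR R),
     (forall j : 'I_n, 0 <= tnth omega j) ->
     let precision : 'M[R]_n :=
       diag_mx (2 *: hadamard (tvec omega) (map_mx gamma y))^T + invmx K in
     let Sigma : 'M[R]_n := invmx precision in
     let mu : 'cV[R]_n :=
       Sigma *m (map_mx g y + hadamard (tvec omega) (map_mx beta y)
                 + invmx K *m mu0) in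
     [/\ precision \in unitmx,
         sym_posdef Sigma &
         complete_conditional (lebesgue_tuple n)
           (fun f => joint mu0 K C g h y f omega)
           (gaussian mu Sigma)]).

Proof.
(* A squared norm is nonnegative at every [t], hence so is its leading coefficient; this keeps the
   diagonal part of the precision nonnegative. *)
have gamma_ge0 i : 0 <= gamma (y i 0).
  by apply: (@quadratic_ge0_lead _ (alpha (y i 0)) (beta (y i 0))) => t;
     rewrite -h_norm sqr_ge0.
have NK := gaussian_norm_gt0 hK.
split=> [i f omega _|omega omega_ge0].
  set c := norm2 _; have c2 : 0 <= c ^+ 2 by exact: sqr_ge0.
  have phi_c := pd_radial_gt0 hphi hpi0 c2.
  have mexp : measurable_fun setT
      (fun w : measurableTypeR R => expR (- (c ^+ 2 * w))).
    by apply: measurableT_comp => //; apply: measurableT_comp => //;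
       exact: measurable_funM.
  have pull A : measurable A -> (\int[pi0]_(w in A)
      (expR (- (c ^+ 2 * w)) / phi (c ^+ 2))%:E =
      \int[pi0]_(w in A) (expR (- (c ^+ 2 * w)))%:E * (phi (c ^+ 2))^-1%:E)%E.
    move=> mA; rewrite -ge0_integralZr//.
    - by apply/measurable_EFinP; exact: measurable_funTS.
    - by rewrite lee_fin invr_ge0 ltW.
  pose e j w := g (y j 0) * tnth f j - norm2 (h (tnth f j) (y j 0)) ^+ 2 * w.
  (* All factors of the joint that do not involve the [i]-th latent variable, times [phi (c ^+ 2)]
     to compensate for the normalization of the density. *)
  pose Z := gaussian_pdf mu0 K (tvec f) * (C * expR (g (y i 0) * tnth f i) *
    \prod_(j < n | j != i) (C * expR (e j (tnth omega j)))) * phi (c ^+ 2).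
  refine (@complete_conditional_density _ (measurableTypeR R) R pi0 _
    (fun w => expR (- (c ^+ 2 * w)) / phi (c ^+ 2)) Z _ _ _ _ _ _ _).
  - rewrite /Z /gaussian_pdf !mulr_gt0 ?expR_gt0// prodr_gt0// => j _.
    by rewrite mulr_gt0 ?expR_gt0.
  - move=> w; rewrite /joint (bigD1 i)//= tnth_mktuple eqxx expRD.
    rewrite (eq_bigr (fun j => C * expR (e j (tnth omega j)))); last first.
      by move=> j /negbTE ji; rewrite tnth_mktuple ji.
    by rewrite /Z -/c; field; exact: lt0r_neq0.
  - exact: measurable_funM.
  - by move=> w; rewrite divr_ge0 ?expR_ge0// ltW.
  - rewrite pull// (integral_inverse_laplace hpi0)// -EFinM divff//.
    exact: lt0r_neq0.
  - by move=> A mA; rewrite pull.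
set d := (_ *: _)^T => precision Sigma mu.
have posP : sym_posdef precision.
  apply: posdef_diagD (posdef_inv hK) => i.
  by rewrite !mxE mulr_ge0// mulr_ge0//; exact: omega_ge0.
have uP := posdef_unit posP.
have posS : sym_posdef Sigma := posdef_inv posP.
split=> //; rewrite /mu; set c := _ + _ + _.
have NS := gaussian_norm_gt0 posS.
(* The part of the log-joint free of [f] once the square is completed, apart from the prior
   normalization and the powers of [C]. *)
pose kappa := (qform precision (Sigma *m c) - qform (invmx K) mu0) / 2 -
  \sum_i alpha (y i 0) * tnth omega i.
(* The proportionality constant trades the normalization of the prior for that of N(mu, Sigma). *)
apply: (@complete_conditional_density _ _ _ _ _
  (fun t => gaussian_pdf (Sigma *m c) Sigma (tvec t))
  ((Num.sqrt ((2 * pi) ^+ n * \det K))^-1 * C ^+ n * expR kappa /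
   (Num.sqrt ((2 * pi) ^+ n * \det Sigma))^-1)) => //.
- by rewrite divr_gt0// mulr_gt0 ?expR_gt0// mulr_gt0// exprn_gt0.
- move=> t; rewrite /joint /gaussian_pdf prod_cst_expR invmxK.
  set x := tvec t; set NSi := (Num.sqrt (_ * \det Sigma))^-1 in NS *.
  have expE : - (qform (invmx K) (x - mu0) / 2) +
      \sum_i (g (y i 0) * tnth t i
               - norm2 (h (tnth t i) (y i 0)) ^+ 2 * tnth omega i) =
      kappa - qform precision (x - Sigma *m c) / 2.
    (* Both squares are expanded; [precision *m (Sigma *m c)] collapses to [c], and the [invmx K]
       parts quadratic in [x] agree on the two sides. *)
    rewrite !qformB ?posP.1 ?(posdef_inv hK).1// mulKVmx// qformDl qform_diag.
    have -> : (x^T *m c) 0 0 =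
        \sum_i x i 0 *
          (map_mx g y + hadamard (tvec omega) (map_mx beta y)) i 0 +
        (x^T *m (invmx K *m mu0)) 0 0.
      by rewrite /c mulmxDr [LHS]mxE; congr (_ + _); exact: dot_sum.
    rewrite /kappa.
    (* Sorting the likelihood exponent by degree in [f]: the [gamma] terms give the form of [d],
       where the factor 2 in [d] cancels the half. *)
    have -> : \sum_i (g (y i 0) * tnth t i
        - norm2 (h (tnth t i) (y i 0)) ^+ 2 * tnth omega i) =
      \sum_i x i 0 * (map_mx g y + hadamard (tvec omega) (map_mx beta y)) i 0
      - 2^-1 * (\sum_i d 0 i * x i 0 ^+ 2)
      - \sum_i alpha (y i 0) * tnth omega i.
      rewrite mulr_sumr -!sumrB; apply: eq_bigr => i _.
      by rewrite h_norm !mxE; field.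
    by field.
  transitivity ((Num.sqrt ((2 * pi) ^+ n * \det K))^-1 * C ^+ n *
    (expR kappa * expR (- (qform precision (x - Sigma *m c) / 2)))).
    by rewrite -expRD -expE expRD; ring.
  by rewrite [RHS]mulrA divfK ?lt0r_neq0// mulrA.
- exact: measurable_gaussian_pdf.
- by move=> t; exact: gaussian_pdf_ge0.
- exact: integral_gaussian_pdf.
Qed.
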